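(* Let $F=\mathbb{F}_2$ or $F=\mathbb{F}_2(t)$ with $t$ transcendental over $\mathbb{F}_2$. Then hyperbolic quadratic forms over $F$ are 2-algebraic, i.e. every hyperbolic quadratic form over $F$ is Witt equivalent to the second trace form $T_{E/F}$ of some finite separable field extension $E/F$ of degree at least $2$.
   Context: $F$ is a field of characteristic $2$. A quadratic form $q$ on a finite-dimensional $F$-space is nonsingular if its associated bilinear form $b_q(x,y)=q(x+y)-q(x)-q(y)$ is nondegenerate. $\mathbb{H}$ denotes the hyperbolic plane, i.e. the form $(x,y)\mapsto xy$ on $F^2$, and $r\mathbb{H}$ is the orthogonal sum of $r$ copies of it. A nonsingular form is hyperbolic if it is isometric to $r\mathbb{H}$ for some $r\ge 0$. Two nonsingular forms $q_1,q_2$ are Witt equivalent if $q_1\perp r\mathbb{H}\cong q_2\perp s\mathbb{H}$ for some $r,s\ge 0$. Second trace form: let $E/F$ be a finite separable field extension of degree $n\ge 2$. For $a\in E$ write the characteristic polynomial of the $F$-linear map $x\mapsto ax$ on $E$ as $x^n-T_1(a)x^{n-1}+T_2(a)x^{n-2}+\cdots+(-1)^nT_n(a)$. The second trace form $T_{E/F}$ is the quadratic form $(E,T_2)$ if $n$ is even, and $(E_0,T_2|_{E_0})$ with $E_0=\operatorname{Ker}T_1$ if $n$ is odd; it is nonsingular. A nonsingular quadratic form over $F$ is called 2-algebraic if it is Witt equivalent to $T_{E/F}$ for some such extension $E/F$. *)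

(* Defs.v *)
From HB Require Import structures.
From mathcomp Require Import all_boot all_order all_fingroup all_algebra all_field.
From mathcomp Require Import ring.

Set Implicit Arguments.
Unset Strict Implicit.
Unset Printing Implicit Defensive.

Import GRing.Theory.
Local Open Scope ring_scope.

Section QuadraticForms.

Variable F : fieldType.

Definition polar (V : zmodType) (q : V -> F) (x y : V) : F :=
  q (x + y) - q x - q y.

(* The polar form is symmetric, so linearity in its first argument is
   bilinearity. *)
Definition is_quadratic (V : lmodType F) (q : V -> F) : Prop :=
  (forall (a : F) (x : V), q (a *: x) = a ^+ 2 * q x) /\
  (forall y : V, scalar (polar q ^~ y)).

Record quadForm := QuadForm {
  qspace : vectType F;
  qfun :> qspace -> F;
  qfunP : is_quadratic qfun
}.

Definition nonsingular (q : quadForm) : Prop :=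
  forall x : qspace q, (forall y : qspace q, polar q x y = 0) -> x = 0.

Definition isometric (q1 q2 : quadForm) : Prop :=
  exists2 f : 'Hom(qspace q1, qspace q2),
    bijective f & forall x, q2 (f x) = q1 x.

Lemma is_quadratic_ext (V : lmodType F) (q q' : V -> F) :
  q =1 q' -> is_quadratic q -> is_quadratic q'.
Proof.
move=> e [qZ qB]; split=> [a x|y a u v]; first by rewrite -!e.
by have := qB y a u v; rewrite /polar -!e.
Qed.

Lemma is_quadratic0 (V : lmodType F) : is_quadratic (fun _ : V => 0 : F).
Proof. by split=> [a x|y a u v]; rewrite /polar; ring. Qed.

Lemma is_quadraticD (V : lmodType F) (q1 q2 : V -> F) :
  is_quadratic q1 -> is_quadratic q2 -> is_quadratic (fun x => q1 x + q2 x).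
Proof.
move=> [Z1 B1] [Z2 B2]; split=> [a x|y a u v]; first by rewrite Z1 Z2 mulrDr.
move: (B1 y a u v) (B2 y a u v); rewrite /polar /= => e1 e2.
by rewrite [LHS](_ : _ = (q1 (a *: u + v + y) - q1 (a *: u + v) - q1 y) +
  (q2 (a *: u + v + y) - q2 (a *: u + v) - q2 y)); [rewrite e1 e2|]; ring.
Qed.

Lemma is_quadraticZ (V : lmodType F) (c : F) (q : V -> F) :
  is_quadratic q -> is_quadratic (fun x => c * q x).
Proof.
move=> [Z B]; split=> [a x|y a u v]; first by rewrite Z mulrCA.
move: (B y a u v); rewrite /polar /= => e.
by rewrite -!mulrBr e mulrDr; congr (_ + _); rewrite mulrCA.
Qed.

Lemma is_quadraticM (V : lmodType F) (f g : V -> F) :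
  scalar f -> scalar g -> is_quadratic (fun x => f x * g x).
Proof.
move=> fl gl.
have sD (h : V -> F) : scalar h -> forall x y, h (x + y) = h x + h y.
  by move=> hl x y; rewrite -[x]scale1r hl mul1r scale1r.
have s0 (h : V -> F) : scalar h -> h 0 = 0.
  by move=> hl; apply: (addIr (h 0)); rewrite -sD // !add0r.
have sZ (h : V -> F) : scalar h -> forall a x, h (a *: x) = a * h x.
  by move=> hl a x; rewrite -[a *: x]addr0 hl s0 // addr0.
split=> [a x|y a u v]; first by rewrite !sZ //; ring.
by rewrite /polar !sD // !sZ //; ring.
Qed.

Lemma is_quadratic_sum (V : lmodType F) (I : Type) (r : seq I)
    (q : I -> V -> F) :
  (forall i, is_quadratic (q i)) -> is_quadratic (fun x => \sum_(i <- r) q i x).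
Proof.
move=> qP; elim: r => [|i r IH].
  by apply: is_quadratic_ext (is_quadratic0 _) => x; rewrite big_nil.
apply: is_quadratic_ext (is_quadraticD (qP i) IH) => x.
by rewrite big_cons.
Qed.

Lemma is_quadratic_comp (U V : lmodType F) (f : {linear U -> V}) (q : V -> F) :
  is_quadratic q -> is_quadratic (fun x => q (f x)).
Proof.
move=> [Z B]; split=> [a x|y a u v]; first by rewrite linearZ Z.
by rewrite /polar !linearD !linearZ; apply: B.
Qed.

Definition qzero : quadForm :=
  @QuadForm 'rV[F]_0 (fun=> 0) (is_quadratic0 _).

Lemma qsum_subproof (q1 q2 : quadForm) :
  is_quadratic (fun x : (qspace q1 * qspace q2)%type => q1 x.1 + q2 x.2).
Proof.
apply: is_quadraticD.
  exact: (@is_quadratic_comp _ _ fst _ (qfunP q1)).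
exact: (@is_quadratic_comp _ _ snd _ (qfunP q2)).
Qed.

Definition qsum (q1 q2 : quadForm) : quadForm :=
  @QuadForm (qspace q1 * qspace q2)%type _ (qsum_subproof q1 q2).

Lemma hyperbolic_plane_subproof :
  is_quadratic (fun x : (F^o * F^o)%type => x.1 * x.2 : F).
Proof. by apply: is_quadraticM. Qed.

Definition hyperbolic_plane : quadForm :=
  @QuadForm (F^o * F^o)%type _ hyperbolic_plane_subproof.

Definition hyperbolic_sum (r : nat) : quadForm :=
  iter r (qsum hyperbolic_plane) qzero.

Definition hyperbolic (q : quadForm) : Prop :=
  nonsingular q /\ exists r : nat, isometric q (hyperbolic_sum r).

Definition Witt_equivalent (q1 q2 : quadForm) : Prop :=
  [/\ nonsingular q1, nonsingular q2 &
      exists r s : nat, isometric (qsum q1 (hyperbolic_sum r))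
                                  (qsum q2 (hyperbolic_sum s))].

End QuadraticForms.

Section SecondTraceForm.

Variables (F : fieldType) (E : fieldExtType F).

(* The matrix of x |-> a * x; its characteristic polynomial does not depend
   on the basis. *)
Definition mult_mx (a : E) : 'M[F]_(\dim {:E}) :=
  passmx.mxof (vbasis {:E}) (vbasis {:E}) (amull a).

(* T_k(a): the characteristic polynomial of x |-> a * x is
   \sum_(k <= n) (-1)^k T_k(a) X^(n - k). The guard avoids truncated
   subtraction. *)
Definition char_coef (k : nat) (a : E) : F :=
  if (k <= \dim {:E})%N
  then (-1) ^+ k * (char_poly (mult_mx a))`_(\dim {:E} - k)
  else 0.

Lemma mult_mx_linear : linear mult_mx.
Proof. by move=> a u v; rewrite /mult_mx linearP passmx.mxof_linear. Qed.

Lemma char_coef1E a : char_coef 1 a = \tr (mult_mx a).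
Proof.
by rewrite /char_coef adim_gt0 subn1 char_poly_trace ?adim_gt0 // mulN1r opprK.
Qed.

Lemma char_coef1_linear : scalar (char_coef 1).
Proof. by move=> a u v; rewrite !char_coef1E mult_mx_linear linearP. Qed.

HB.instance Definition _ := GRing.isSemilinear.Build F E F _ (char_coef 1)
  (GRing.semilinear_linear char_coef1_linear).

Definition traceless : {vspace E} :=
  lker (linfun (char_coef 1 : E -> F^o)).

Lemma memv_traceless a : (a \in traceless) = (char_coef 1 a == 0).
Proof. by rewrite memv_ker lfunE. Qed.

(* The factor 'X^2 shifts indices, so that the coefficients of degree d, d - 1
   and d - 2 of a product of d = size r linear factors are all defined. *)
Lemma prod_coef_quadratic (I : Type) (r : seq I) (c : I -> F) (l : I -> E -> F) :
    (forall i, scalar (l i)) ->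
  let S v := 'X^2 * \prod_(i <- r) ((c i)%:P * 'X + (l i v)%:P) in
  [/\ forall v k, (size r + 2 < k)%N -> (S v)`_k = 0,
      exists c0, forall v, (S v)`_(size r).+2 = c0,
      scalar (fun v => (S v)`_(size r).+1) &
      is_quadratic (fun v => (S v)`_(size r))].
Proof.
move=> ll; elim: r => [|i r [IH3 [c0 IH2] IH1 IH0]] S.
  have SE v : S v = 'X^2 by rewrite /S big_nil mulr1.
  split=> [v||a u v|].
  - by move=> k lt_k; rewrite SE coefXn gtn_eqF.
  - by exists 1 => v; rewrite SE coefXn.
  - by rewrite -/(S _) -/(S u) -/(S v) !SE !coefXn /=; ring.
  - by apply: is_quadratic_ext (is_quadratic0 _) => v; rewrite SE coefXn.
pose P v := 'X^2 * \prod_(j <- r) ((c j)%:P * 'X + (l j v)%:P).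
have SE v k : (S v)`_k.+1 = c i * (P v)`_k + l i v * (P v)`_k.+1.
  rewrite /S big_cons mulrCA -/(P v) mulrDl -mulrA coefD !coefCM.
  by rewrite coefXM.
split=> [v||a u v|].
- case=> // k; rewrite SE /= addSn ltnS => lt_k.
  by rewrite !IH3 ?mulr0 ?addr0 // ltnW.
- by exists (c i * c0) => v; rewrite /= SE IH2 IH3 ?addn2 // mulr0 addr0.
- have := IH1 a u v; rewrite /= !SE !IH2 (ll i) => ->; ring.
- apply: (@is_quadratic_ext _ _
    (fun v => c i * (P v)`_(size r) + l i v * (P v)`_(size r).+1)).
    by move=> v; rewrite /= SE.
  by apply: is_quadraticD; [apply: is_quadraticZ | apply: is_quadraticM].
Qed.

Lemma char_coef2_quadratic : is_quadratic (char_coef 2).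
Proof.
set n := \dim {:E}.
pose l (s : 'S_n) (i : 'I_n) (v : E) : F := - mult_mx v i (s i).
pose S (s : 'S_n) v := 'X^2 * \prod_(i <- index_enum 'I_n)
  (((i == s i)%:R : F)%:P * 'X + (l s i v)%:P).
apply: (@is_quadratic_ext _ _ (fun v => \sum_(s : 'S_n) (-1) ^+ s * (S s v)`_n)).
  move=> v; transitivity (('X^2 * char_poly (mult_mx v))`_n).
    rewrite /char_poly /determinant mulr_sumr coef_sum; apply: eq_bigr => s _.
    rewrite mulrCA -(rmorph_sign (@polyC F)) coefCM /S; congr (_ * _).
    congr (_ _ n); congr polyseq; congr (_ * _).
    apply: eq_bigr => i _; rewrite /l; move: (mult_mx v) => A; rewrite !mxE polyCN; congr (_ - _).
    by case: eqP => _; rewrite ?mulr1n ?mulr0n ?mul1r ?mul0r.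
  rewrite coefXnM /char_coef -/n leqNgt ltnS; case: ltnP => //= _.
  by rewrite sqrrN expr1n mul1r.
have ls s i : scalar (l s i).
  move=> a u v; rewrite /l mult_mx_linear; move: (mult_mx u) (mult_mx v).
  by move=> A B; rewrite !mxE; ring.
apply: is_quadratic_sum => s; apply: is_quadraticZ.
have [_ _ _] := prod_coef_quadratic (index_enum 'I_n)
  (fun i => (i == s i)%:R : F) (ls s).
suff -> : size (index_enum 'I_n) = n by [].
by rewrite [index_enum _]unlock -enumT size_enum_ord.
Qed.

Definition second_trace_form : quadForm F :=
  if odd (\dim {:E}) then
    @QuadForm F (subvs_of traceless) (fun x => char_coef 2 (vsval x))
      (@is_quadratic_comp _ _ _ vsval _ char_coef2_quadratic)
  else @QuadForm F E (char_coef 2) char_coef2_quadratic.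

End SecondTraceForm.

Definition two_algebraic (F : fieldType) (q : quadForm F) : Prop :=
  nonsingular q /\
  exists E : fieldExtType F,
    [/\ separable 1%AS {:E}, (2 <= \dim {:E})%N &
        Witt_equivalent q (second_trace_form E)].

(* Main.v *)
From HB Require Import structures.
Require Import Defs.
From mathcomp Require Import all_boot all_order all_fingroup all_algebra all_field.
From mathcomp Require Import ring.

(** One field extension serves both base fields and all hyperbolic forms.

    Two hyperbolic forms q1, q2, isometric to r and s hyperbolic planes, are
    always Witt equivalent: q1 plus s planes and q2 plus r planes are both
    r + s planes ([hyperbolic_Witt_equivalent]).  So it is enough to find one
    separable extension E / F whose second trace form is hyperbolic.

    Take E = F(z) with z ^ 4 = z + 1, that is E = F_16 when F = F_2 and
    E = F_16(t) when F = F_2(t).  In the basis 1, z, z ^ 2, z ^ 3 the matrix of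
    multiplication by a0 + a1 z + a2 z ^ 2 + a3 z ^ 3 is explicit, and the sum
    of its principal 2 x 2 minors is, in characteristic 2,
      T_2 = a3 (a0 + a3) + a1 a2,
    visibly a sum of two hyperbolic planes ([char_coef2E],
    [second_trace_form_hyperbolic]).

    There remains to see that X ^ 4 + X + 1 is irreducible over F
    ([quartic_irreducible]).  If x is a root then x ^ 2 + x is a root of
    Y ^ 2 + Y + 1, and a factorization into two quadratics also forces a root of
    Y ^ 2 + Y + 1 in F.  So what is used of F, besides its characteristic, is
    that the form x ^ 2 + x y + y ^ 2 has no nontrivial zero.  This is clear
    over F_2, and it passes from a domain R to R[t] (divide by t as long as the
    constant terms vanish) and to the fractions of R (clear denominators). *)

Set Implicit Arguments.
Unset Strict Implicit.
Unset Printing Implicit Defensive.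

Import GRing.Theory.
Local Open Scope ring_scope.

(** * The form x ^ 2 + x y + y ^ 2 over F_2(t) *)

(** The form is the norm form of the algebra obtained by adjoining a primitive
    cube root of unity.  Being homogeneous, it allows division by a common
    factor and clearing of denominators, unlike the equation
    Y ^ 2 + Y + 1 = 0. *)
Definition cube_root_norm_anisotropic (R : nzRingType) : Prop :=
  forall x y : R, x ^+ 2 + x * y + y ^+ 2 = 0 -> x = 0 /\ y = 0.

Lemma anisotropic_F2 : cube_root_norm_anisotropic 'F_2.
Proof. by case=> [[|[|//]] hx] [[|[|//]] hy] // _; split; apply/val_inj. Qed.

(** Descent on the degree: the constant terms of a zero form a zero over [R], so
    they vanish, and dividing both entries by the variable gives a smaller
    zero. *)
Lemma anisotropic_poly (R : idomainType) :
  cube_root_norm_anisotropic R -> cube_root_norm_anisotropic {poly R}.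
Proof.
move=> anisoR; elim/poly_ind => [|p c IH] q.
  by rewrite expr0n mul0r !add0r => /eqP; rewrite expf_eq0 => /eqP.
elim/poly_ind: q => [|q d _] E0.
  by move/eqP: E0; rewrite expr0n mulr0 !addr0 expf_eq0 => /eqP.
have [c0 d0] : c = 0 /\ d = 0.
  apply: anisoR; have := congr1 (horner^~ 0) E0.
  by rewrite !hornerE.
move: E0; rewrite c0 d0 !addr0 => E0.
have /IH [-> ->] : p ^+ 2 + p * q + q ^+ 2 = 0; last by rewrite !mul0r.
apply: (mulIf (x := 'X^2)); first by rewrite expf_neq0 // polyX_eq0.
by rewrite mul0r -[RHS]E0; ring.
Qed.

Lemma fraction_div (R : idomainType) (x : {fraction R}) :
  exists a b : R, b != 0 /\ x = tofrac a / tofrac b.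
Proof.
elim/quotW: x => u; exists \n_u, \d_u; split; first exact: denom_ratioP.
apply: canRL (mulfK _) _; first by rewrite tofrac_eq0 denom_ratioP.
unlock tofrac; rewrite -[LHS]FracField.pi_mul; apply/eqmodP.
rewrite /= FracField.equivfE /FracField.mulf /=.
by rewrite !numden_Ratio ?mulf_neq0 ?oner_eq0 ?denom_ratioP // !mulr1 mulrC.
Qed.

Lemma norm_form_clear_denominators (K : fieldType) (a b c d : K) :
  b != 0 -> d != 0 ->
  (a * d) ^+ 2 + (a * d) * (c * b) + (c * b) ^+ 2 =
  (b * d) ^+ 2 * ((a / b) ^+ 2 + (a / b) * (c / d) + (c / d) ^+ 2).
Proof. by move=> nz_b nz_d; field; rewrite nz_b nz_d. Qed.

Lemma anisotropic_fraction (R : idomainType) :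
  cube_root_norm_anisotropic R -> cube_root_norm_anisotropic {fraction R}.
Proof.
move=> anisoR x y.
have [a [b [nz_b ->]]] := fraction_div x.
have [c [d [nz_d ->]]] := fraction_div y => E0.
have [nzb nzd] : tofrac b != 0 /\ tofrac d != 0 by rewrite !tofrac_eq0.
have /anisoR [] : (a * d) ^+ 2 + (a * d) * (c * b) + (c * b) ^+ 2 = 0.
  apply/eqP; rewrite -tofrac_eq0 !(rmorphD, rmorphXn, rmorphM) /=.
  by rewrite norm_form_clear_denominators // E0 mulr0.
move=> /eqP + /eqP; rewrite !mulf_eq0 (negPf nz_d) (negPf nz_b) !orbF.
by move=> /eqP-> /eqP->; rewrite rmorph0 !mul0r.
Qed.

(** * Irreducibility of X ^ 4 + X + 1 *)

Section Quartic.

Variable F : fieldType.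
Hypothesis char2 : 2%N \in [pchar F].
Hypothesis anisoF : cube_root_norm_anisotropic F.

Definition quartic : {poly F} := 'X^4 + 'X + 1.

Lemma size_quartic : size quartic = 5%N.
Proof.
rewrite /quartic -addrA size_polyDl size_polyXn //.
by rewrite size_polyDl size_polyX // size_poly1.
Qed.

Let two0 : 1 + 1 = 0 :> F.
Proof. exact: addrr_pchar2. Qed.

Lemma primitive_cube_root_free (u : F) : u ^+ 2 + u + 1 != 0.
Proof.
apply/eqP => E0; have [_ /eqP] : u = 0 /\ 1 = 0 :> F.
  by apply: anisoF; rewrite mulr1 expr1n.
by rewrite oner_eq0.
Qed.

(** X ^ 4 + X + 1 is Y ^ 2 + Y + 1 at Y = X ^ 2 + X. *)
Lemma quartic_root_free (x : F) : ~~ root quartic x.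
Proof.
apply/rootP; rewrite !hornerE => E0.
have /eqP := primitive_cube_root_free (x ^+ 2 + x); apply.
rewrite -[RHS](addr0 0) -{1}E0 -(mul0r (x ^+ 3 + x ^+ 2)) -two0; ring.
Qed.

(** The hypotheses say that X ^ 4 + X + 1 is the product of X ^ 2 + u X + v and
    X ^ 2 + u X + w.  They give u ^ 3 = 1, so u = 1 as there are no primitive
    cube roots of unity, and then v is a root of Y ^ 2 + Y + 1. *)
Lemma quartic_no_quadratic_factor (u v w : F) :
  v * w = 1 -> u * (v + w) = 1 -> v + w = u ^+ 2 -> False.
Proof.
move=> vw uvw vDw.
have u3 : u ^+ 3 = 1 by rewrite -uvw vDw; ring.
have u1 : u = 1.
  have : (u - 1) * (u ^+ 2 + u + 1) = u ^+ 3 - 1 by ring.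
  rewrite u3 subrr => /eqP; rewrite mulf_eq0 subr_eq0.
  by rewrite (negPf (primitive_cube_root_free u)) orbF => /eqP.
have /eqP := primitive_cube_root_free v; apply.
have : v * u ^+ 2 = v ^+ 2 + v * w by rewrite -vDw; ring.
rewrite u1 expr1n mulr1 vw => v_sq.
by rewrite {2}v_sq -[RHS](mul0r (v ^+ 2 + 1)) -two0; ring.
Qed.

Lemma quartic_irreducible : irreducible_poly quartic.
Proof.
split=> [|q sz_q_neq1 /dvdpP[r def_p]]; first by rewrite size_quartic.
have nz_p : quartic != 0 by rewrite -size_poly_eq0 size_quartic.
have [nz_r nz_q] : r != 0 /\ q != 0 by apply/norP; rewrite -mulf_eq0 -def_p.
have := size_quartic; rewrite {1}def_p size_mul //.
have no_lin (s : {poly F}) : s %| quartic -> size s != 2%N.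
  move=> s_dv; apply/eqP => sz_s; have [x] := poly2_root sz_s; apply/negP.
  by apply: contra (quartic_root_free x); apply: root_dvdp.
have r_dv : r %| quartic by rewrite def_p dvdp_mulr.
have q_dv : q %| quartic by rewrite def_p dvdp_mull.
have := no_lin _ r_dv; have := no_lin _ q_dv; move: nz_r nz_q.
rewrite -!size_poly_gt0.
case sz_r: (size r) sz_q_neq1 => [|[|[|[|[|k]]]]];
  case sz_q: (size q) => [|[|[|[|[|[]]]]]] //=.
- by move=> *; rewrite -dvdp_size_eqp // sz_q size_quartic.
- move=> _ _ _ _ _ _; exfalso.
  have coef_rq k : (r * q)`_k = quartic`_k by rewrite def_p.
  have [r3 q3] : (forall k, r`_k.+3 = 0) /\ (forall k, q`_k.+3 = 0).
    by split=> k; rewrite nth_default // (sz_r, sz_q).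
  move: (coef_rq 0) (coef_rq 1) (coef_rq 2) (coef_rq 3) (coef_rq 4).
  rewrite /quartic !coefM !big_ord_recl !big_ord0 /= /bump /= !addn0 /= !r3 !q3.
  rewrite !coefD !coefXn !coefX !coef1 /= !(mulr0, mul0r, addr0, add0r).
  set r0 := r`_0; set r1 := r`_1; set r2 := r`_2.
  set q0 := q`_0; set q1 := q`_1; set q2 := q`_2.
  rewrite -/(r0 * q0 = 1) -/(r0 * q1 + r1 * q0 = 1).
  rewrite -/(r0 * q2 + (r1 * q1 + r2 * q0) = 0) -/(r1 * q2 + r2 * q1 = 0).
  rewrite -/(r2 * q2 = 1) => E0 E1 E2 E3' E4.
  have E3 : r1 * q2 = r2 * q1.
    by apply/eqP; rewrite -subr_eq0 oppr_pchar2 // E3'.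
  (* The factors are not monic: each is scaled by the leading coefficient of
     the other, which is legitimate since r2 * q2 = 1. *)
  apply: (@quartic_no_quadratic_factor (r1 * q2) (q0 * r2) (r0 * q2)).
  - by rewrite -[RHS]mulr1 -{2}E4 -E0; ring.
  - transitivity ((r2 * q2) * (r0 * q1 + r1 * q0)); last by rewrite E4 E1 mulr1.
    by rewrite mulrDr {2}E3; ring.
  have -> : (r1 * q2) ^+ 2 = (r2 * q2) * (r1 * q1) by rewrite expr2 {2}E3; ring.
  apply/eqP; rewrite E4 mul1r -subr_eq0 oppr_pchar2 // -E2; apply/eqP; ring.
all: by rewrite !addnS.
Qed.

End Quartic.

(** * Characteristic polynomials *)

Lemma char_poly_conj (R : comNzRingType) n (A B P Q : 'M[R]_n) :
  P *m Q = 1%:M -> P *m A = B *m P -> char_poly A = char_poly B.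
Proof.
move=> PQ PA; have detP : \det (map_mx polyC P) * \det (map_mx polyC Q) = 1.
  by rewrite -det_mulmx -map_mxM PQ map_mx1 det1.
have conjE :
    map_mx polyC P *m char_poly_mx A = char_poly_mx B *m map_mx polyC P.
  by rewrite /char_poly_mx mulmxBr mulmxBl -!map_mxM PA scalar_mxC.
rewrite /char_poly -[LHS]mul1r -[RHS]mulr1 -detP mulrAC.
by rewrite -det_mulmx conjE det_mulmx mulrA.
Qed.

(** [mult_mx] is written in the basis [vbasis], of which nothing is known; the
    characteristic polynomial can be computed in any basis at hand. *)
Lemma char_poly_mult_mx (F : fieldType) (E : fieldExtType F) n (e : n.-tuple E)
    (A : 'M[F]_n) (a : E) :
  basis_of {:E} e -> (forall i : 'I_n, a * e`_i = \sum_j A i j *: e`_j) ->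
  char_poly (mult_mx a) = char_poly A.
Proof.
move=> e_basis A_def; have n_dim : n = \dim {:E}.
  by rewrite (size_basis e_basis).
subst n.
have v_basis : basis_of {:E} (vbasis {:E}) := vbasisP _.
have -> : A = passmx.mxof e e (amull a).
  apply/row_matrixP => i; rewrite !rowE passmx.mul_mxof passmx.vecof_delta.
  rewrite lfunE /= A_def -rowE.
  have -> : \sum_j A i j *: e`_j = passmx.vecof e (row i A).
    by apply: eq_bigr => j _; rewrite mxE.
  by rewrite passmx.vecofK.
apply: (@char_poly_conj _ _ _ _ (passmx.mxof e (vbasis {:E}) \1)
  (passmx.mxof (vbasis {:E}) e \1)).
  by rewrite -passmx.mxof_comp // comp_lfun1l passmx.mxof1 //
     (basis_free e_basis).
by rewrite /mult_mx -!passmx.mxof_comp // comp_lfun1l comp_lfun1r.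
Qed.

(** Laplace expansion along the first two rows. *)
Lemma det4 (R : comNzRingType) (M : nat -> nat -> R) :
  let m2 i j k l := M i k * M j l - M i l * M j k in
  \det (\matrix_(i < 4, j < 4) M i j) =
    m2 0%N 1%N 0%N 1%N * m2 2%N 3%N 2%N 3%N
    - m2 0%N 1%N 0%N 2%N * m2 2%N 3%N 1%N 3%N
    + m2 0%N 1%N 0%N 3%N * m2 2%N 3%N 1%N 2%N
    + m2 0%N 1%N 1%N 2%N * m2 2%N 3%N 0%N 3%N
    - m2 0%N 1%N 1%N 3%N * m2 2%N 3%N 0%N 2%N
    + m2 0%N 1%N 2%N 3%N * m2 2%N 3%N 0%N 1%N.
Proof.
move=> m2; rewrite /m2 (expand_det_row _ ord0) !big_ord_recl big_ord0 /cofactor.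
rewrite !(expand_det_row (_ : 'M_3) ord0) !big_ord_recl !big_ord0 /cofactor.
rewrite !(expand_det_row (_ : 'M_2) ord0) !big_ord_recl !big_ord0 /cofactor.
rewrite !det_mx11 !mxE /= /bump /= ?addn0 ?add0n ?add1n.
move: (M 0%N 0%N) (M 0%N 1%N) (M 0%N 2%N) (M 0%N 3%N) => a00 a01 a02 a03.
move: (M 1%N 0%N) (M 1%N 1%N) (M 1%N 2%N) (M 1%N 3%N) => a10 a11 a12 a13.
move: (M 2%N 0%N) (M 2%N 1%N) (M 2%N 2%N) (M 2%N 3%N) => a20 a21 a22 a23.
move: (M 3%N 0%N) (M 3%N 1%N) (M 3%N 2%N) (M 3%N 3%N) => a30 a31 a32 a33.
ring.
Qed.

Lemma char_poly4_coef2 (R : comNzRingType) (M : nat -> nat -> R) :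
  let m2 i j := M i i * M j j - M i j * M j i in
  (char_poly (\matrix_(i < 4, j < 4) M i j))`_2 =
    m2 0%N 1%N + m2 0%N 2%N + m2 0%N 3%N + m2 1%N 2%N + m2 1%N 3%N + m2 2%N 3%N.
Proof.
move=> m2.
(* The linear coefficient is minus the sum c1 of the principal 3 x 3 minors;
   m3 is such a minor, by the rule of Sarrus. *)
pose m3 i j k := M i i * M j j * M k k + M i j * M j k * M k i
  + M i k * M j i * M k j - M i i * M j k * M k j - M j j * M i k * M k i
  - M k k * M i j * M j i.
pose c1 := m3 0%N 1%N 2%N + m3 0%N 1%N 3%N + m3 0%N 2%N 3%N + m3 1%N 2%N 3%N.
pose c3 := M 0%N 0%N + M 1%N 1%N + M 2%N 2%N + M 3%N 3%N.
set c2 := RHS.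
have -> : char_poly (\matrix_(i < 4, j < 4) M i j) =
    'X^4 - c3%:P * 'X^3 + c2%:P * 'X^2 - c1%:P * 'X
    + (\det (\matrix_(i < 4, j < 4) M i j))%:P.
  have -> : char_poly (\matrix_(i < 4, j < 4) M i j) =
      \det (\matrix_(i < 4, j < 4) ('X *+ (i == j :> nat) - (M i j)%:P)).
    by congr (\det _); apply/matrixP=> i j; rewrite !mxE.
  rewrite (det4 (fun i j => 'X *+ (i == j) - (M i j)%:P)) det4.
  rewrite /c1 /c2 /c3 /m2 /m3 /= !mulr1n !mulr0n.
  rewrite !(polyCD, polyCN, polyCM).
  move: ((M 0%N 0%N)%:P) ((M 0%N 1%N)%:P) ((M 0%N 2%N)%:P) ((M 0%N 3%N)%:P)
    => a00 a01 a02 a03.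
  move: ((M 1%N 0%N)%:P) ((M 1%N 1%N)%:P) ((M 1%N 2%N)%:P) ((M 1%N 3%N)%:P)
    => a10 a11 a12 a13.
  move: ((M 2%N 0%N)%:P) ((M 2%N 1%N)%:P) ((M 2%N 2%N)%:P) ((M 2%N 3%N)%:P)
    => a20 a21 a22 a23.
  move: ((M 3%N 0%N)%:P) ((M 3%N 1%N)%:P) ((M 3%N 2%N)%:P) ((M 3%N 3%N)%:P)
    => a30 a31 a32 a33.
  move: ('X : {poly R}) => x; ring.
rewrite !(coefD, coefB, coefCM, coefXn, coefX, coefC, coefN) /=.
by rewrite !mulr0 mulr1 subr0 !addr0 subr0 add0r.
Qed.

(** * Hyperbolic forms *)

Section Forms.

Variable F : fieldType.
Implicit Types q : quadForm F.

Lemma isometric_of_linear q1 q2 (f : qspace q1 -> qspace q2) :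
  linear f -> bijective f -> (forall x, q2 (f x) = q1 x) -> isometric q1 q2.
Proof.
move=> f_lin f_bij f_iso.
pose fL : {linear qspace q1 -> qspace q2} := HB.pack f
  (GRing.isSemilinear.Build F (qspace q1) (qspace q2) *:%R f
     (GRing.semilinear_linear f_lin)).
have fLE : linfun fL =1 f by move=> x; rewrite lfunE.
exists (linfun fL); last by move=> x; rewrite fLE.
by apply: eq_bij f_bij _ _ => x; rewrite fLE.
Qed.

Lemma isometric_nonsingular q1 q2 :
  isometric q1 q2 -> nonsingular q2 -> nonsingular q1.
Proof.
move=> [f [g fK gK] f_iso] ns2 x x_rad; apply: (can_inj fK).
rewrite linear0; apply: ns2 => y; rewrite -(gK y) -(x_rad (g y)).
by rewrite /polar -linearD !f_iso.
Qed.

Lemma qfun0 q : q 0 = 0.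
Proof.
by have [qZ _] := qfunP q; rewrite -(scale0r 0) qZ expr0n mul0r.
Qed.

Lemma nonsingular_qsum q1 q2 :
  nonsingular q1 -> nonsingular q2 -> nonsingular (qsum q1 q2).
Proof.
move=> ns1 ns2 [x1 x2] x_rad; congr pair.
- apply: ns1 => y; rewrite -(x_rad (y, 0)) /polar /= addr0 qfun0; ring.
- apply: ns2 => y; rewrite -(x_rad (0, y)) /polar /= addr0 qfun0; ring.
Qed.

Lemma nonsingular_hyperbolic_plane : nonsingular (hyperbolic_plane F).
Proof.
move=> [x y] xy_rad; congr pair.
- by rewrite -(xy_rad (0, 1)) /polar /=; ring.
- by rewrite -(xy_rad (1, 0)) /polar /=; ring.
Qed.

Lemma nonsingular_hyperbolic_sum r : nonsingular (hyperbolic_sum F r).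
Proof.
elim: r => [|r IH]; first by move=> x _; rewrite (thinmx0 x).
exact: nonsingular_qsum nonsingular_hyperbolic_plane IH.
Qed.

(** Each form is identified with its sum of planes, and the two summands are
    exchanged. *)
Lemma hyperbolic_Witt_equivalent q1 q2 :
  hyperbolic q1 -> hyperbolic q2 -> Witt_equivalent q1 q2.
Proof.
move=> [ns1 [r [f [f' fK f'K] f_iso]]] [ns2 [s [g [g' gK g'K] g_iso]]].
split=> //; exists s, r.
pose h (x : qspace (qsum q1 (hyperbolic_sum F s))) :
  qspace (qsum q2 (hyperbolic_sum F r)) := (g' x.2, f x.1).
have g'_lin : linear g' by exact: can2_linear gK g'K.
apply: (@isometric_of_linear _ _ h).
- by move=> a x y; rewrite /h /= g'_lin linearP.
- exists (fun y => (f' y.2, g y.1)) => -[x y] /=; first by rewrite /h /= fK g'K.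
  by rewrite /h /= gK f'K.
- by move=> [x y]; rewrite /h /= -g_iso g'K f_iso addrC.
Qed.

End Forms.

(** * The second trace form of F(z), z ^ 4 = z + 1 *)

Section QuarticExtension.

Variables (F : fieldType) (E : fieldExtType F) (z : E).
Hypotheses (char2 : 2%N \in [pchar F]) (dimE : \dim {:E} = 4%N).
Hypotheses (z_root : root (map_poly (in_alg E) (quartic F)) z).
Hypotheses (z_gen : <<1; z>>%VS = fullv).

Let char2E : 2%N \in [pchar E].
Proof. exact: (rmorph_pchar (in_alg E)). Qed.

Let z4 : z ^+ 4 = z + 1.
Proof.
move/rootP: z_root; rewrite /quartic !rmorphD /= map_polyXn map_polyX rmorph1.
by rewrite !hornerE -addrA => /eqP; rewrite addr_eq0 oppr_pchar2 // => /eqP.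
Qed.

Definition power_basis : 4.-tuple E := [tuple of [:: 1; z; z ^+ 2; z ^+ 3]].

Lemma power_basisP : basis_of {:E} power_basis.
Proof.
rewrite basisEdim dimE leqnn andbT -z_gen Fadjoin_eq_sum /Fadjoin_sum.
have -> : adjoin_degree 1%AS z = 4%N.
  by have := dim_Fadjoin 1%AS z; rewrite z_gen dimE dimv1 muln1.
apply/subv_sumP => i _; rewrite prod1v -memvE memv_span //.
by case: i => [[|[|[|[|//]]]] ?]; rewrite !inE /= ?expr0 ?expr1 eqxx ?orbT.
Qed.

(** The derivative of X ^ 4 + X + 1 is 1. *)
Lemma quartic_separable : separable 1%AS {:E}.
Proof.
rewrite -z_gen -adjoin_separable_eq.
apply/separable_elementP; exists (map_poly (in_alg E) (quartic F)); split=> //.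
  by apply/polyOverP => i; rewrite coef_map /= memvZ ?mem1v.
have char2P : 2%N \in [pchar {poly F}] := rmorph_pchar (@polyC F) char2.
have quartic' : (quartic F)^`() = 1.
  rewrite /quartic !derivD derivXn derivX -(polyC1 F) derivC polyC1 addr0.
  by rewrite (mulrnA _ 2 2) mulr2n addrr_pchar2 // add0r.
by rewrite separable_map separable_poly.unlock quartic' coprimep1.
Qed.

(** Indexed by natural numbers, so that indices compute; the value at [k >= 4]
    is junk. *)
Definition power_coord (x : E) (k : nat) : F := coord power_basis (inord k) x.

Lemma power_coord_linear k : scalar (power_coord^~ k).
Proof. by move=> a x y; rewrite /power_coord linearP. Qed.

Lemma power_coordK x : \sum_(k < 4) power_coord x k *: z ^+ k = x.
Proof.
rewrite [RHS](coord_basis power_basisP) ?memvf //; apply: eq_bigr => k _.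
rewrite /power_coord inord_val; congr (_ *: _).
by case: k => [[|[|[|[|//]]]] ?].
Qed.

Lemma power_coord_sum (u : nat -> F) k :
  (k < 4)%N -> power_coord (\sum_(j < 4) u j *: z ^+ j) k = u k.
Proof.
move=> lt_k.
have -> : \sum_(j < 4) u j *: z ^+ j = \sum_(j < 4) u j *: power_basis`_j.
  by apply: eq_bigr => -[[|[|[|[|//]]]] ?].
by rewrite /power_coord coord_sum_free ?(basis_free power_basisP) // inordK.
Qed.

(** Row [i] holds the coordinates of a z ^ i, reduced by z ^ 4 = z + 1. *)
Definition mult_mx_entry (a : nat -> F) (i j : nat) : F :=
  nth 0 (nth [::] [:: [:: a 0%N; a 1%N; a 2%N; a 3%N];
                      [:: a 3%N; a 0%N + a 3%N; a 1%N; a 2%N];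
                      [:: a 2%N; a 2%N + a 3%N; a 0%N + a 3%N; a 1%N];
                      [:: a 1%N; a 1%N + a 2%N; a 2%N + a 3%N;
                          a 0%N + a 3%N]] i) j.

Lemma mult_mx_entryP (a : nat -> F) (i : 'I_4) :
  (\sum_(j < 4) a j *: z ^+ j) * z ^+ i =
  \sum_(j < 4) mult_mx_entry a i j *: z ^+ j.
Proof.
(* The scalars as an abstract additive map into E, so that both sides become
   polynomial expressions in E. *)
have [k kE kD] : exists2 k : F -> E,
    forall c v, c *: v = k c * v & {morph k : x y / x + y}.
  by exists (in_alg E) => [c v|c d]; rewrite ?mulr_algl ?rmorphD.
rewrite !big_ord_recl !big_ord0 /= /bump /= !kE.
have reduce y u v : u - v = y * (z ^+ 4 - (z + 1)) -> u = v.
  by rewrite z4 subrr mulr0 => /eqP; rewrite subr_eq0 => /eqP.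
(* In each row the multiplier is the part of a z ^ i of degree at least 4,
   divided by z ^ 4. *)
case: i => [[|[|[|[|//]]]] ?] /=; rewrite /mult_mx_entry /= ?kD.
- by apply: (@reduce 0); ring.
- by apply: (@reduce (k (a 3%N))); ring.
- by apply: (@reduce (k (a 2%N) + k (a 3%N) * z)); ring.
- by apply: (@reduce (k (a 1%N) + k (a 2%N) * z + k (a 3%N) * z ^+ 2)); ring.
Qed.

(** In terms of the coordinates, the sum of the principal 2 x 2 minors is
    6 c0 ^ 2 + 9 c0 c3 + 3 c3 ^ 2 - 4 c1 c3 - 2 c2 ^ 2 - 3 c1 c2, and the
    right-hand side is its reduction modulo 2. *)
Lemma char_coef2E x (c := power_coord x) :
  char_coef 2 x = c 3%N * (c 0%N + c 3%N) + c 1%N * c 2%N.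
Proof.
have mulE (i : 'I_4) : x * power_basis`_i = \sum_j
    (\matrix_(i < 4, j < 4) mult_mx_entry c i j) i j *: power_basis`_j.
  have pbE (k : 'I_4) : power_basis`_k = z ^+ k.
    by case: k => [[|[|[|[|//]]]] ?].
  rewrite -{1}(power_coordK x) pbE mult_mx_entryP.
  by apply: eq_bigr => j _; rewrite pbE mxE.
have cpE := char_poly_mult_mx power_basisP mulE.
rewrite /char_coef cpE dimE /= char_poly4_coef2 /mult_mx_entry /=.
rewrite sqrrN expr1n mul1r.
move: (c 0%N) (c 1%N) (c 2%N) (c 3%N) => c0 c1 c2 c3.
have two0 : 1 + 1 = 0 :> F by exact: addrr_pchar2.
(* Half the difference of the two sides. *)
pose h := 3 * c0 ^+ 2 + 4 * c0 * c3 + c3 ^+ 2 - 2 * c1 * c3 - c2 ^+ 2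
  - 2 * c1 * c2.
by rewrite -[RHS]addr0 -(mul0r h) -two0 /h; ring.
Qed.

(** As the degree 4 is even, the form lives on all of E. *)
Lemma second_trace_form_hyperbolic : hyperbolic (second_trace_form E).
Proof.
have iso : isometric (second_trace_form E) (hyperbolic_sum F 2).
  rewrite /second_trace_form dimE /=; set q := QuadForm _.
  pose f (x : qspace q) : qspace (hyperbolic_sum F 2) :=
    let c := power_coord x in
    ((c 3%N, c 0%N + c 3%N), ((c 1%N, c 2%N), 0)).
  pose u (y : qspace (hyperbolic_sum F 2)) : nat -> F :=
    nth 0 [:: y.1.2 - y.1.1; y.2.1.1; y.2.1.2; y.1.1].
  apply: (@isometric_of_linear _ q _ f).
  - move=> a x y; rewrite /f /= !power_coord_linear.
    congr (_, _); congr (_, _); rewrite ?addr0 //.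
      by rewrite addrACA -mulrDr.
    by rewrite /= scaler0.
  - exists (fun y => \sum_(j < 4) u y j *: z ^+ j).
      move=> x; rewrite -[RHS]power_coordK; apply: eq_bigr => j _.
      by congr (_ *: _); case: j => [[|[|[|[|//]]]] ?] //=; rewrite /u /= addrK.
    move=> [[p1 p2] [[p3 p4] p5]]; rewrite /f !power_coord_sum // /u /= subrK.
    by rewrite (thinmx0 p5).
  - by move=> x; rewrite /= addr0 char_coef2E.
split; last by exists 2%N.
exact: (isometric_nonsingular iso (@nonsingular_hyperbolic_sum F 2)).
Qed.

End QuarticExtension.

(** * Hyperbolic forms are 2-algebraic *)

Theorem hyperbolic_two_algebraic (F : fieldType) (q : quadForm F) :
  2%N \in [pchar F] -> cube_root_norm_anisotropic F -> hyperbolic q ->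
  two_algebraic q.
Proof.
move=> char2 anisoF q_hyp; split; first by case: q_hyp.
have [E dimE [z z_root z_gen]] :=
  irredp_FAdjoin (quartic_irreducible char2 anisoF).
rewrite size_quartic /= in dimE; exists E; split.
- exact: quartic_separable char2 z_root z_gen.
- by rewrite dimE.
apply: hyperbolic_Witt_equivalent q_hyp _.
exact: second_trace_form_hyperbolic char2 dimE z_root z_gen.
Qed.

Theorem theorem3 :
  (forall q : quadForm 'F_2, hyperbolic q -> two_algebraic q) /\
  (forall q : quadForm {fraction {poly 'F_2}}, hyperbolic q -> two_algebraic q).
Proof.
have char2 : 2%N \in [pchar 'F_2] by exact: pchar_Fp.
split=> q; apply: hyperbolic_two_algebraic => //.
- exact: anisotropic_F2.
- have char2P : 2%N \in [pchar {poly 'F_2}] := rmorph_pchar (@polyC _) char2.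
  exact: (rmorph_pchar (@tofrac {poly 'F_2}) char2P).
- exact: anisotropic_fraction (anisotropic_poly anisotropic_F2).
Qed.
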